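(* Let $(\phi_t)$ be a parabolic semigroup of zero hyperbolic step in $\mathbb{H}$ with Denjoy--Wolff point $\infty$, and let its infinitesimal generator $G\colon\mathbb{H}\to\mathbb{H}\cup\mathbb{R}$ have Herglotz representation $G(z)=\alpha z+\beta+\int_{\mathbb{R}}\frac{1+sz}{s-z}\,d\mu(s)$ ($\alpha\ge0$, $\beta\in\mathbb{R}$, $\mu$ positive finite measure). The following are equivalent: (a) $(\phi_t)$ is of extremal rate; (b) $\limsup_{t\to+\infty}|\phi_t(z)|/\sqrt{t}<+\infty$ for some $z\in\mathbb{H}$ (equivalently, for all $z\in\mathbb{H}$); (c) $\alpha=0$, $\int_{\mathbb{R}}s^2\,d\mu(s)<+\infty$, and $\beta=\int_{\mathbb{R}}s\,d\mu(s)$. Moreover, if these hold, then for all $z\in\mathbb{H}$, $$\lim_{t\to+\infty}\frac{\phi_t(z)}{\sqrt t}=i\sqrt{2\int_{\mathbb{R}}(1+s^2)\,d\mu(s)}.$$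
   Context: $\mathbb{H}$ is the upper half-plane. A semigroup in $\mathbb{H}$ is a family $(\phi_t)_{t\ge0}$ of holomorphic self-maps of $\mathbb{H}$ with $\phi_0=\mathrm{id}$, $\phi_{t+s}=\phi_t\circ\phi_s$, and $\phi_t\to\mathrm{id}$ pointwise as $t\to0^+$. Non-elliptic: no $z\in\mathbb{H}$, $t>0$ with $\phi_t(z)=z$; then all orbits converge to a common boundary point (the Denjoy--Wolff point). With Denjoy--Wolff point $\infty$: parabolic means $\angle\lim_{z\to\infty}\phi_t(z)/z=1$ for all $t$. Zero hyperbolic step means $\lim_{t\to+\infty}d_{\mathbb{H}}(\phi_{t+1}(z),\phi_t(z))=0$ for some (equivalently all) $z$, where $d_{\mathbb{H}}$ is the hyperbolic distance $d_{\mathbb{H}}(z,w)=\frac12\log\frac{1+\rho}{1-\rho}$, $\rho=|z-w|/|z-\bar w|$. Such a semigroup is of extremal rate if there is $L\in(0,+\infty)$ with $\lim_{t\to+\infty}|\phi_t(z)|/\sqrt t=L$ for all $z\in\mathbb{H}$. The infinitesimal generator $G$ satisfies $\partial_t\phi_t(z)=G(\phi_t(z))$. *)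

(* Defs.v *)
From HB Require Import structures.
From mathcomp Require Import all_boot all_order all_algebra.
From mathcomp Require Import all_classical all_reals all_analysis.
From mathcomp Require Import complex.
Import Order.TTheory GRing.Theory Num.Theory.
Import numFieldNormedType.Exports.

Set Implicit Arguments.
Unset Strict Implicit.
Unset Printing Implicit Defensive.

Local Open Scope classical_set_scope.
Local Open Scope ring_scope.

(* The complex plane, as a normed field over itself (for complex derivatives
   and limits). *)
Notation CC R := ((R[i])^o).

Section HalfPlane.
Variable R : realType.

Definition cmod (z : CC R) : R := Num.sqrt (complex.Re z ^+ 2 + complex.Im z ^+ 2).

Definition cconj (z : CC R) : CC R := Complex (complex.Re z) (- complex.Im z).

Definition UHP : set (CC R) := [set z | 0 < complex.Im z].

Definition holo_self_map (f : CC R -> CC R) : Prop :=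
  forall z, UHP z -> UHP (f z) /\ derivable f z 1.

Definition semigroup_H (phi : R -> CC R -> CC R) : Prop :=
  [/\ (forall t, 0 <= t -> holo_self_map (phi t)),
      (forall z, UHP z -> phi 0 z = z),
      (forall t s, 0 <= t -> 0 <= s -> forall z, UHP z ->
          phi (t + s) z = phi t (phi s z)) &
      (forall z, UHP z -> phi t z @[t --> 0^'+] --> z)].

Definition non_elliptic (phi : R -> CC R -> CC R) : Prop :=
  forall t, 0 < t -> forall z, UHP z -> phi t z <> z.

Definition DW_point_infty (phi : R -> CC R -> CC R) : Prop :=
  forall z, UHP z -> cmod (phi t z) @[t --> +oo] --> +oo.

(* angular (non-tangential) limit at infinity in H: f z -> l as z -> infinity
   inside every Stolz angle { z in H | Im z >= delta |z| }, 0 < delta. *)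
Definition angular_lim_infty (f : CC R -> CC R) (l : CC R) : Prop :=
  forall delta : R, 0 < delta -> forall eps : R, 0 < eps ->
  exists M : R, forall z : CC R, UHP z -> delta * cmod z <= complex.Im z ->
    M <= cmod z -> cmod (f z - l) < eps.

Definition parabolic (phi : R -> CC R -> CC R) : Prop :=
  forall t, 0 <= t -> angular_lim_infty (fun z => phi t z / z) 1.

Definition dH (z w : CC R) : R :=
  let rho := cmod (z - w) / cmod (z - cconj w) in
  2^-1 * ln ((1 + rho) / (1 - rho)).

Definition zero_hyperbolic_step (phi : R -> CC R -> CC R) : Prop :=
  exists z, UHP z /\ dH (phi (t + 1) z) (phi t z) @[t --> +oo] --> 0.

Definition extremal_rate (phi : R -> CC R -> CC R) : Prop :=
  exists L : R, 0 < L /\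
    forall z, UHP z -> cmod (phi t z) / Num.sqrt t @[t --> +oo] --> L.

(* G is the infinitesimal generator: G : H -> H u R holomorphic and
   d/dt phi_t(z) = G(phi_t(z)) for all t >= 0 (one-sided at t = 0). *)
Definition infinitesimal_generator (phi : R -> CC R -> CC R)
    (G : CC R -> CC R) : Prop :=
  [/\ (forall z, UHP z -> derivable G z 1),
      (forall z, UHP z -> 0 <= complex.Im (G z)) &
      (forall t, 0 <= t -> forall z, UHP z ->
        (phi (t + h) z - phi t z) / (h%:C)%C
          @[h --> within (fun h : R => h != 0 /\ 0 <= t + h) (nbhs 0)]
          --> G (phi t z))].

Definition cintegral (mu : {finite_measure set R -> \bar R}) (f : R -> CC R)
    : CC R :=
  Complex (Rintegral mu setT (fun s => complex.Re (f s)))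
          (Rintegral mu setT (fun s => complex.Im (f s))).

Definition herglotz_repr (G : CC R -> CC R) (alpha beta : R)
    (mu : {finite_measure set R -> \bar R}) : Prop :=
  forall z, UHP z ->
    G z = (alpha%:C)%C * z + (beta%:C)%C
          + cintegral mu (fun s => (1 + (s%:C)%C * z) / ((s%:C)%C - z)).

End HalfPlane.

(* Main.v *)
Require Import Defs.
From HB Require Import structures.
From mathcomp Require Import all_boot all_order all_algebra.
From mathcomp Require Import all_classical all_reals all_analysis.
From mathcomp Require Import complex.
From mathcomp Require Import measurable_realfun.
From mathcomp Require Import ring lra.
Import Order.TTheory GRing.Theory Num.Theory.
Import numFieldNormedType.Exports.
Local Open Scope classical_set_scope.
Local Open Scope ring_scope.

(** Everything follows from the equation [x' + i y' = G (x + i y)] along an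
    orbit.

    If [|phi_t| <= C sqrt t], then the logarithmic derivative
    [y' / y = alpha + \int (1 + s^2) / |s - z|^2 dmu] cannot exceed [1 / (2 t)]
    on average, since [y <= C sqrt t]; this forces [alpha = 0] and bounds the
    truncations of [\int (1 + s^2) dmu]. Hence [m := \int (1 + s^2) dmu] is
    finite and [G z = b + \int (1 + s^2) / (s - z) dmu] with
    [b = beta - \int s dmu]. The last integral is at most
    [e m + (y' / y) / (4 e)] in modulus, whose time average is arbitrarily
    small, so [x] drifts at speed [b] and [b = 0].

    Conversely, if [G z = \int (1 + s^2) / (s - z) dmu], then
    [(z^2)' = 2 z G z] tends to [- 2 m] as [z] tends to infinity
    non-tangentially. An orbit starting high on the imaginary axis therefore
    never leaves the sector [|x| <= y], and every other orbit stays at bounded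
    hyperbolic distance from it (Schwarz--Pick), hence is non-tangential as
    well. So [z^2 ~ - 2 m t]. *)

(** * Monotonicity, growth and limits of real functions read off from derivatives *)

Section RealAnalysis.
Set Implicit Arguments.
Unset Strict Implicit.
Context {R : realType}.
Implicit Types (f g y : R -> R) (a b c e k l s t : R).

Lemma is_derive_le0_nincr f g s t : s <= t ->
  (forall u, s <= u -> u <= t -> is_derive u 1 f (g u)) ->
  (forall u, s < u -> u < t -> g u <= 0) -> f t <= f s.
Proof.
rewrite le_eqVlt => /predU1P[->//|st] df g0.
have [u|x|u /[!in_itv]/= /andP[su ut] E] := @MVT R f g s t st.
- by rewrite in_itv/= => /andP[su ut]; apply: df; exact: ltW.
- apply: derivable_within_continuous => u.
  by rewrite in_itv/= => /andP[su ut]; have [] := df u su ut.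
- rewrite -subr_le0 E; have := g0 u su ut.
  by move=> gu; rewrite mulr_le0_ge0// subr_ge0 ltW.
Qed.

Lemma is_derive_ge0_ndecr f g s t : s <= t ->
  (forall u, s <= u -> u <= t -> is_derive u 1 f (g u)) ->
  (forall u, s < u -> u < t -> 0 <= g u) -> f s <= f t.
Proof.
move=> st df g0; rewrite -lerN2.
apply: (@is_derive_le0_nincr (- f) (- g)) => // u su ut.
  by have fu := df u su ut; exact: is_deriveN.
by rewrite oppr_le0 g0.
Qed.

(** At the first time [tau] with [0 <= f tau], [f] would have been nonincreasing on [[s, tau]], so
    [f tau <= f s < 0]. The sign of [g] is needed only where [f] is negative, which suits the
    trapping of an orbit in a sector. *)
Lemma lt0_barrier f g s :
  (forall t, s <= t -> is_derive t 1 f (g t)) ->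
  (forall t, s <= t -> f t < 0 -> g t <= 0) ->
  f s < 0 -> forall t, s <= t -> f t < 0.
Proof.
move=> df g0 fs T sT; rewrite ltNge; apply/negP => fT.
pose S := [set t | s <= t <= T /\ 0 <= f t].
have S0 : S T by split=> //; rewrite sT lexx.
have lS : has_lbound S by exists s => t [/andP[]].
have hS : has_inf S by split => //; exists T.
set tau := inf S.
have stau : s <= tau by apply: lb_le_inf; [exists T|move=> t [/andP[]]].
have tauT : tau <= T by exact: ge_inf.
have cf t : s <= t -> f x @[x --> t] --> f t.
  move=> st; have [fd _] := df t st.
  exact/differentiable_continuous/derivable1_diffP.
(* If [f tau < 0], then [f < 0] near [tau] by continuity, while points of [S] lie arbitrarily close
   to its infimum. *)
have ftau : 0 <= f tau.
  rewrite leNgt; apply/negP => ft0.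
  have /nbhs_ballP[e /= e0 be] : \forall x \near tau, f x < 0.
    exact: (cvgr_lt _ (cf _ stau) _ ft0).
  have [u [/andP[su uT] fu] ue] := inf_adherent e0 hS.
  have tu : tau <= u by apply: ge_inf => //; split => //; rewrite su.
  have : f u < 0.
    apply: be; rewrite /ball/= distrC ger0_norm ?subr_ge0//.
    by rewrite ltrBlDl.
  by rewrite ltNge fu.
have : f tau <= f s.
  apply: (@is_derive_le0_nincr f g s tau stau) => [u su _|u su ut].
    exact: df.
  apply: g0; first exact: ltW.
  rewrite ltNge; apply/negP => fu.
  have : tau <= u.
    apply: ge_inf => //; split => //.
    by rewrite (ltW su) (le_trans (ltW ut)).
  by rewrite leNgt ut.
by rewrite leNgt (lt_le_trans fs).
Qed.

(** Beyond some [T], [f t - (l + e / 2) t] is nonincreasing and [f t - (l - e / 2) t] nondecreasing.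
    The constants left over from time [T] are absorbed by [e / 2 * t]. *)
Lemma is_derive_cvg_slope f g l :
  (forall t, 0 < t -> is_derive t 1 f (g t)) ->
  g t @[t --> +oo] --> l -> f t / t @[t --> +oo] --> l.
Proof.
move=> df gl; apply/cvgrPdist_le => /= e e0.
have e2 : 0 < e / 2 by rewrite divr_gt0.
move/cvgrPdist_le: gl => /(_ _ e2)[M [_ gM]].
pose T : R := Num.max M 0 + 1.
have T0 : 0 < T by rewrite ltr_pwDr// le_max lexx orbT.
have MT : M < T by rewrite ltr_pwDr// le_max lexx.
have up t : T <= t -> f t - (l + e / 2) * t <= f T - (l + e / 2) * T.
  move=> Tt; apply: (@is_derive_le0_nincr (fun u => f u - (l + e / 2) * u)
    (fun u => g u - (l + e / 2))) => // u Tu ut.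
    have fu := df u (lt_le_trans T0 Tu).
    apply: is_derive_eq; rewrite /GRing.scale/=; ring.
  have := gM u (lt_trans MT Tu); rewrite ler_norml => /andP[h1 h2]; lra.
have dn t : T <= t -> f T - (l - e / 2) * T <= f t - (l - e / 2) * t.
  move=> Tt; apply: (@is_derive_ge0_ndecr (fun u => f u - (l - e / 2) * u)
    (fun u => g u - (l - e / 2))) => // u Tu ut.
    have fu := df u (lt_le_trans T0 Tu).
    apply: is_derive_eq; rewrite /GRing.scale/=; ring.
  have := gM u (lt_trans MT Tu); rewrite ler_norml => /andP[h1 h2]; lra.
(* Bounds both constants [f T - (l + e / 2) T] and [f T - (l - e / 2) T] in modulus. *)
pose K : R := `|f T| + (`|l| + e / 2) * T.
near=> t.
have Tt : T <= t by near: t; apply: nbhs_pinfty_ge; rewrite num_real.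
have Kt : 2 * K / e <= t by near: t; apply: nbhs_pinfty_ge; rewrite num_real.
have t0 : 0 < t := lt_le_trans T0 Tt.
have {}Kt : K <= e / 2 * t.
  move: Kt; rewrite ler_pdivrMr// => ?; lra.
have fT := ler_norm (f T); have fT' := ler_norm (- f T).
have lT : - `|l| * T <= l * T.
  by rewrite ler_pM2r// lerNl; have := ler_norm (- l); rewrite normrN.
have lT' : l * T <= `|l| * T by rewrite ler_pM2r// ler_norm.
rewrite normrN in fT'.
have {}up := up t Tt; have {}dn := dn t Tt; rewrite /K in Kt.
set q := f t / t; have qt : f t = q * t by rewrite /q divfK// gt_eqF.
rewrite qt in up dn.
have eT : 0 <= e * T by rewrite mulr_ge0 ?ltW.
by rewrite ler_norml; apply/andP; split; rewrite -(ler_pM2r t0); lra.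
Unshelve. all: by end_near.
Qed.

Lemma is_derive_ln_comp y dy t : 0 < y t -> is_derive t 1 y dy ->
  is_derive t 1 (fun u => ln (y u)) (dy / y t).
Proof.
move=> y0 dyt; have lnd := is_derive1_ln y0.
by have := is_derive1_comp lnd dyt; rewrite mulrC.
Qed.

Lemma linear_le_sqrt a b c s :
  (forall t, s <= t -> a * t <= b * Num.sqrt t + c) -> a <= 0.
Proof.
move=> h; rewrite leNgt; apply/negP => a0.
pose B := `|b| + `|c| + 1.
have B1 : 1 <= B by rewrite /B; have := normr_ge0 b; have := normr_ge0 c; lra.
(* The test time is [r^2]: it exceeds [s], and [a r > B] with [r >= 1] gives
   [a r^2 > B r >= b r + c]. *)
pose r := Num.max (B / a + 1) (`|s| + 1).
have r1 : 1 <= r by rewrite /r le_max; apply/orP; right; have := normr_ge0 s; lra.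
have r0 : 0 <= r by lra.
have sr : s <= r ^+ 2.
  have : `|s| + 1 <= r by rewrite /r le_max lexx orbT.
  have := ler_norm s; nra.
have Br : B < a * r.
  have : B / a + 1 <= r by rewrite /r le_max lexx.
  rewrite -(ler_pM2l a0) mulrDr mulrCA divff ?gt_eqF// => ?; lra.
have := h _ sr; rewrite sqrtr_sqr ger0_norm// leNgt => /negP; apply.
have := ler_norm b; have := ler_norm c; have := normr_ge0 b; have := normr_ge0 c.
rewrite /B in Br B1; move=> *; nra.
Qed.

(** The lower bound on [y'] makes [ln y - k ln t] nondecreasing, while [y <= c sqrt t] bounds it
    above by [ln c + (1 / 2 - k) ln t], which tends to [-oo] if [k > 1 / 2]. *)
Lemma sqrt_growth_exponent y y' k c s : 0 < s ->
  (forall t, s <= t -> is_derive t 1 y (y' t)) ->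
  (forall t, s <= t -> 0 < y t) ->
  (forall t, s <= t -> k / t * y t <= y' t) ->
  (forall t, s <= t -> y t <= c * Num.sqrt t) -> k <= 1 / 2.
Proof.
move=> s0 dy y0 ky yc.
pose F t := ln (y t) - k * ln t.
have F_ndecr t : s <= t -> F s <= F t.
  move=> st; apply: (@is_derive_ge0_ndecr F (fun t => y' t / y t - k / t)) => //.
    move=> u su _; have u0 := lt_le_trans s0 su.
    have d1 := is_derive_ln_comp (y0 u su) (dy u su).
    have d2 := is_derive1_ln u0.
    by apply: is_derive_eq; rewrite /GRing.scale/=; ring.
  move=> u su _; rewrite subr_ge0 ler_pdivlMr ?y0 ?ky// ltW//.
have c0 : 0 < c.
  have := yc s (lexx _); have := y0 s (lexx _) => h1 /(lt_le_trans h1).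
  by rewrite pmulr_lgt0// sqrtr_gt0.
rewrite leNgt; apply/negP => k2.
pose M := F s - ln c.
(* [r] is the logarithm of the test time; monotonicity gives [(k - 1 / 2) r <= - M], which the
   summand [1] violates. *)
pose r := Num.max (ln s) (- M / (k - 1 / 2) + 1).
have sr : s <= expR r.
  by rewrite -[leLHS]lnK ?posrE// ler_expR /r le_max lexx.
have := F_ndecr _ sr; rewrite /F expRK.
have : ln (y (expR r)) <= ln c + r / 2.
  have -> : r / 2 = ln (Num.sqrt (expR r)).
    have e0 : 0 < Num.sqrt (expR r) by rewrite sqrtr_gt0 expR_gt0.
    have : ln (Num.sqrt (expR r) ^+ 2) = r by rewrite sqr_sqrtr ?expR_ge0// expRK.
    by rewrite lnXn// mulr2n => ?; lra.
  have e0 : 0 < Num.sqrt (expR r) by rewrite sqrtr_gt0 expR_gt0.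
  rewrite -lnM ?posrE// ler_ln ?posrE ?mulr_gt0 ?y0//; exact: yc.
have : - M / (k - 1 / 2) + 1 <= r by rewrite /r le_max lexx orbT.
have kk : 0 < k - 1 / 2 by lra.
rewrite -(ler_pM2l kk) mulrDr mulrCA divff ?gt_eqF// /M /F => *; lra.
Qed.
End RealAnalysis.

(** * The kernels of the Herglotz representation and their integrals *)

Section HerglotzIntegrals.
Set Implicit Arguments.
Unset Strict Implicit.
Context {R : realType} (mu : {finite_measure set R -> \bar R}).
Implicit Types (f g h k : R -> R) (a b c d e s t x y K : R) (n : nat).

Local Notation I f := (Rintegral mu setT f).
Local Notation integrable f := (mu.-integrable setT (EFin \o f)).

Definition weight s := 1 + s ^+ 2.
(* For [z = x + i y], [weight s / (s - z) = reker x y s + i * y * imker x y s]. *)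
Definition imker x y s := weight s / ((s - x) ^+ 2 + y ^+ 2).
Definition reker x y s := weight s * (s - x) / ((s - x) ^+ 2 + y ^+ 2).
(** A smooth truncation of [weight]: bounded by [n + 1], hence integrable for finite [mu], and
    increasing to [weight] with [n]. *)
Definition truncw n s := weight s / (1 + s ^+ 2 / n.+1%:R).
(** Dominates, up to a constant, the deviation of [z G z] from its limit in a sector; it is below
    [weight] and tends to 0 as [y] grows. *)
Definition tailw y s := weight s * `|s| / (`|s| + y).

Lemma weight_gt0 s : 0 < weight s.
Proof. by rewrite /weight; nra. Qed.

Lemma kerden_gt0 x y s : 0 < y -> 0 < (s - x) ^+ 2 + y ^+ 2.
Proof. by move=> y0; rewrite ltr_wpDl ?sqr_ge0 ?exprn_gt0. Qed.

Lemma measurable_weight : measurable_fun setT weight.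
Proof. by apply: measurable_funD => //; exact: measurable_funX. Qed.

Lemma measurable_inv_gt0 f : measurable_fun setT f -> (forall s, 0 < f s) ->
  measurable_fun setT (fun s => (f s)^-1).
Proof.
move=> mf f0; apply: (eq_measurable_fun (fun s => (f s) `^ (-1))).
  by move=> s _; rewrite powR_inv1// ltW.
exact: measurableT_comp (measurable_powR _) mf.
Qed.

Lemma measurable_kerden x y :
  measurable_fun setT (fun s => (s - x) ^+ 2 + y ^+ 2).
Proof.
by apply: measurable_funD => //; apply: measurable_funX; exact: measurable_funB.
Qed.

Lemma measurable_imker x y : 0 < y -> measurable_fun setT (imker x y).
Proof.
move=> y0; apply: measurable_funM; first exact: measurable_weight.
apply: measurable_inv_gt0; first exact: measurable_kerden.
by move=> s; exact: kerden_gt0.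
Qed.

Lemma measurable_reker x y : 0 < y -> measurable_fun setT (reker x y).
Proof.
move=> y0; apply: measurable_funM.
  by apply: measurable_funM; [exact: measurable_weight|exact: measurable_funB].
apply: measurable_inv_gt0; first exact: measurable_kerden.
by move=> s; exact: kerden_gt0.
Qed.

Lemma truncden_ge1 n s : 1 <= 1 + s ^+ 2 / n.+1%:R.
Proof. by rewrite lerDl divr_ge0// sqr_ge0. Qed.

Lemma truncden_gt0 n s : 0 < 1 + s ^+ 2 / n.+1%:R.
Proof. exact: lt_le_trans (truncden_ge1 n s). Qed.

Lemma measurable_truncw n : measurable_fun setT (truncw n).
Proof.
apply: measurable_funM; first exact: measurable_weight.
apply: measurable_inv_gt0; last exact: truncden_gt0.
by apply: measurable_funD => //; apply: measurable_funM => //; exact: measurable_funX.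
Qed.

Lemma tailden_gt0 y s : 0 < y -> 0 < `|s| + y.
Proof. by move=> y0; rewrite ltr_wpDl. Qed.

Lemma measurable_tailw y : 0 < y -> measurable_fun setT (tailw y).
Proof.
move=> y0; apply: measurable_funM.
  apply: measurable_funM; [exact: measurable_weight|exact: normr_measurable].
apply: measurable_inv_gt0; last by move=> s; exact: tailden_gt0.
by apply: measurable_funD => //; exact: normr_measurable.
Qed.

Lemma integrable_le f g : measurable_fun setT f -> integrable g ->
  (forall s, `|f s| <= g s) -> integrable f.
Proof.
move=> mf ig fg; apply: le_integrable ig => //; first exact/measurable_EFinP.
by move=> s _ /=; rewrite lee_fin (le_trans (fg s))// ler_norm.
Qed.

Lemma integrable_bounded f K : measurable_fun setT f ->
  (forall s, `|f s| <= K) -> integrable f.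
Proof.
move=> mf fK; apply: (@integrable_le f (cst K)) => //.
by apply: finite_measure_integrable_cst.
Qed.

Lemma integrable_lin a b f g : integrable f -> integrable g ->
  integrable (fun s => a * f s + b * g s).
Proof.
move=> fi gi.
have -> : EFin \o (fun s => a * f s + b * g s) =
  ((fun s => a%:E * (EFin \o f) s) \+ (fun s => b%:E * (EFin \o g) s))%E by [].
by apply: integrableD => //; exact: integrableZl.
Qed.

Lemma Rintegral_lin a b f g : integrable f -> integrable g ->
  I (fun s => a * f s + b * g s) = a * I f + b * I g.
Proof.
move=> fi gi; rewrite RintegralD//.
- by rewrite !RintegralZl.
- exact: (integrableZl measurableT a fi).
- exact: (integrableZl measurableT b gi).
Qed.

(** Transfers pointwise linear inequalities between kernels to their integrals; with fewer than four
    kernels, the spare slots repeat one with coefficient 0 or split its coefficient. *)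
Lemma Rintegral_lin4_le0 a b c d f g h k :
  integrable f -> integrable g -> integrable h -> integrable k ->
  (forall s, a * f s + b * g s + (c * h s + d * k s) <= 0) ->
  a * I f + b * I g + (c * I h + d * I k) <= 0.
Proof.
move=> fi gi hi ki le0.
have i1 := integrable_lin a b fi gi; have i2 := integrable_lin c d hi ki.
have := integrable_lin 1 1 i1 i2; have := Rintegral_lin 1 1 i1 i2.
rewrite !mul1r (Rintegral_lin a b fi gi) (Rintegral_lin c d hi ki) => <- i3.
rewrite -oppr_ge0.
rewrite -mulN1r -RintegralZl//; apply: Rintegral_ge0 => s _.
by rewrite mulN1r oppr_ge0 !mul1r.
Qed.

Lemma imker_ge0 x y s : 0 <= imker x y s.
Proof. by rewrite divr_ge0 ?(ltW (weight_gt0 _))// addr_ge0 ?sqr_ge0. Qed.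

Lemma integrable_imker x y : 0 < y -> integrable (imker x y).
Proof.
move=> y0.
(* From [s^2 <= 2 (s - x)^2 + 2 x^2], with the remaining [1 + 2 x^2] compared to [y^2]. *)
apply: (@integrable_bounded _ (2 + (1 + 2 * x ^+ 2) / y ^+ 2)).
  exact: measurable_imker.
move=> s; rewrite ger0_norm ?imker_ge0// /imker ler_pdivrMr ?kerden_gt0//.
have y2 : 0 < y ^+ 2 by nra.
have : (1 + 2 * x ^+ 2) <= (1 + 2 * x ^+ 2) / y ^+ 2 * ((s - x) ^+ 2 + y ^+ 2).
  rewrite mulrDr divfK ?gt_eqF// lerDr mulr_ge0 ?sqr_ge0// divr_ge0 ?ltW//; nra.
rewrite /weight [X in _ -> _ <= X]mulrDl => h; apply: le_trans (lerD (lexx _) h).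
have := sqr_ge0 (s - 2 * x); have := sqr_ge0 y; lra.
Qed.

Lemma truncw_ge0 n s : 0 <= truncw n s.
Proof. by rewrite divr_ge0 ?(ltW (weight_gt0 _)) ?(ltW (truncden_gt0 _ _)). Qed.

Lemma integrable_truncw n : integrable (truncw n).
Proof.
apply: (@integrable_bounded _ n.+1%:R); first exact: measurable_truncw.
move=> s; rewrite ger0_norm ?truncw_ge0// /truncw ler_pdivrMr ?truncden_gt0//.
rewrite mulrDr mulr1 mulrCA divff ?pnatr_eq0// mulr1 /weight lerD2r.
by rewrite ler1n.
Qed.

(** [(s - x)^2 + y^2 <= 2 s^2 + 2 K], and [s^2 <= K s^2 / (n + 1)]. Along a slow orbit this is used
    with [K] proportional to [t]. *)
Lemma imker_ge_truncw n K x y s : 0 < y -> n.+1%:R <= K ->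
  x ^+ 2 + y ^+ 2 <= K -> truncw n s <= 2 * K * imker x y s.
Proof.
move=> y0 nK xyK; have n0 : 0 < n.+1%:R :> R by rewrite ltr0n.
rewrite /truncw /imker mulrCA ler_pM2l ?weight_gt0//.
rewrite -[leLHS]mul1r ler_pdivrMr ?truncden_gt0//.
rewrite mulrAC ler_pdivlMr ?kerden_gt0// mul1r.
have : s ^+ 2 <= K * (s ^+ 2 / n.+1%:R).
  rewrite mulrCA; apply: ler_peMr; first exact: sqr_ge0.
  by rewrite ler_pdivlMr// mul1r.
move: (s ^+ 2 / _) => u ?; have := sqr_ge0 (s + x); have := sqr_ge0 y; lra.
Qed.

Lemma Rintegral_imker_ge n K x y : 0 < y -> n.+1%:R <= K ->
  x ^+ 2 + y ^+ 2 <= K -> I (truncw n) <= 2 * K * I (imker x y).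
Proof.
move=> y0 nK xyK.
have := @Rintegral_lin4_le0 1 (- (2 * K)) 0 0 _ _ _ _ (integrable_truncw n)
  (integrable_imker x y0) (integrable_imker x y0) (integrable_imker x y0).
rewrite !mul0r !addr0 !mul1r mulNr subr_le0; apply => s.
by rewrite !mul0r !addr0 mul1r mulNr subr_le0 imker_ge_truncw.
Qed.

Lemma truncw_cvg s : truncw n s @[n --> \oo] --> weight s.
Proof.
rewrite -[X in _ --> X]divr1; apply: cvgM; first exact: cvg_cst.
apply: cvgV; first exact: oner_neq0.
rewrite -[X in _ --> X]addr0; apply: cvgD; first exact: cvg_cst.
rewrite -(mulr0 (s ^+ 2)); apply: cvgM; first exact: cvg_cst.
exact: cvg_harmonic.
Qed.

Lemma truncw_ndecr s n m : (n <= m)%N -> truncw n s <= truncw m s.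
Proof.
move=> nm; rewrite /truncw ler_pM2l ?weight_gt0//.
rewrite lef_pV2 ?posrE ?truncden_gt0// lerD2l ler_wpM2l ?sqr_ge0//.
by rewrite lef_pV2 ?posrE ?ltr0n// ler_nat.
Qed.

(** Monotone convergence of [truncw n] to [weight]. *)
Lemma integrable_weight_of_truncw K : (forall n, I (truncw n) <= K) ->
  integrable weight.
Proof.
move=> tK.
have mt n : measurable_fun setT (EFin \o truncw n).
  by apply/measurable_EFinP; exact: measurable_truncw.
apply/integrableP; split; first by apply/measurable_EFinP; exact: measurable_weight.
have -> : (\int[mu]_s `|(EFin \o weight) s| =
    \int[mu]_s limn (fun n => (truncw n s)%:E))%E.
  apply: eq_integral => s _; apply/esym/cvg_lim => //=.
  rewrite ger0_norm ?(ltW (weight_gt0 _))//.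
  by apply: cvg_EFin; [exact: nearW|exact: truncw_cvg].
rewrite monotone_convergence//; first last.
- by move=> s _ n m nm; rewrite lee_fin truncw_ndecr.
- by move=> n s _; rewrite lee_fin truncw_ge0.
apply: (@le_lt_trans _ _ K%:E); last exact: ltry.
apply: lime_le.
  apply: ereal_nondecreasing_is_cvgn => n m nm; apply: ge0_le_integral => //.
  - by move=> s _; rewrite lee_fin truncw_ge0.
  - exact: mt.
  - exact: mt.
  - by move=> s _; rewrite lee_fin truncw_ndecr.
apply: nearW => n; have := tK n; rewrite /Rintegral -lee_fin fineK//.
by apply: integrable_fin_num => //; exact: integrable_truncw.
Qed.

Lemma integrable_weightP :
  integrable weight <-> (\int[mu]_s (s ^+ 2)%:E < +oo)%E.
Proof.
have msq : measurable_fun setT (fun s : R => s ^+ 2) by exact: measurable_funX.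
have abs_sq : (\int[mu]_s `|(s ^+ 2)%:E| = \int[mu]_s (s ^+ 2)%:E)%E.
  by apply: eq_integral => s _; rewrite abse_EFin ger0_norm ?sqr_ge0.
split=> [iw|sq].
  have isq : integrable (fun s => s ^+ 2).
    apply: (integrable_le msq iw) => s.
    by rewrite ger0_norm ?sqr_ge0// /weight lerDr.
  by move/integrableP: isq => [_]; rewrite /= abs_sq.
have isq : integrable (fun s => s ^+ 2).
  apply/integrableP; split; first exact/measurable_EFinP.
  by rewrite /= abs_sq.
have i1 : integrable (cst 1) by exact: finite_measure_integrable_cst.
have := integrable_lin 1 1 i1 isq; congr (mu.-integrable _ _).
by apply/funext => s; rewrite /= /weight !mul1r.
Qed.

(** * Estimates under a finite second moment *)

Section FiniteSecondMoment.
Hypothesis iw : integrable weight.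

Lemma integrable_id : integrable (fun s => s).
Proof.
apply: (@integrable_le (fun s => s) weight) => // s.
rewrite /weight -(real_normK (num_real s)); move: `|s| => u.
by have := sqr_ge0 (u - 1); nra.
Qed.

Lemma integral_id_EFin : (\int[mu]_s s%:E = (I (fun s => s))%:E)%E.
Proof. by rewrite fineK//; exact: (integrable_fin_num _ integrable_id). Qed.

Lemma Rintegral_imker_le x y : 0 < y -> I (imker x y) <= I weight / y ^+ 2.
Proof.
move=> y0; have ii := integrable_imker x y0.
have := @Rintegral_lin4_le0 1 (- (y ^+ 2)^-1) 0 0 _ _ _ _ ii iw iw iw.
rewrite !mul0r !addr0 mul1r mulNr subr_le0 [leRHS]mulrC; apply => s.
rewrite !mul0r !addr0 mul1r mulNr subr_le0 mulrC ler_pM2l ?weight_gt0//.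
by rewrite lef_pV2 ?posrE ?kerden_gt0 ?exprn_gt0// lerDr sqr_ge0.
Qed.

Lemma tailw_ge0 y s : 0 < y -> 0 <= tailw y s.
Proof.
by move=> y0; rewrite divr_ge0 ?mulr_ge0 ?(ltW (weight_gt0 _)) ?(ltW (tailden_gt0 _ y0)).
Qed.

Lemma tailw_le y s : 0 < y -> tailw y s <= weight s.
Proof.
move=> y0; rewrite /tailw -mulrA ler_piMr ?(ltW (weight_gt0 _))//.
by rewrite ler_pdivrMr ?tailden_gt0// mul1r lerDl ltW.
Qed.

Lemma integrable_tailw y : 0 < y -> integrable (tailw y).
Proof.
move=> y0; apply: (integrable_le (measurable_tailw y0) iw) => s.
by rewrite ger0_norm ?tailw_ge0// tailw_le.
Qed.

Lemma Rintegral_tailw_nincr x y : 0 < x -> x <= y -> I (tailw y) <= I (tailw x).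
Proof.
move=> x0 xy; have y0 := lt_le_trans x0 xy.
apply: le_Rintegral => //; [exact: integrable_tailw|exact: integrable_tailw|].
move=> s _; rewrite ler_wpM2l ?mulr_ge0 ?(ltW (weight_gt0 _))//.
by rewrite lef_pV2 ?posrE ?tailden_gt0// lerD2l.
Qed.

(** Dominated convergence along [y = n + 1], with [weight] as dominating function; monotonicity in
    [y] then covers all larger reals. *)
Lemma Rintegral_tailw_small e : 0 < e ->
  exists M, 0 < M /\ forall y, M <= y -> I (tailw y) <= e.
Proof.
move=> e0.
have mt n : measurable_fun setT (EFin \o tailw n.+1%:R).
  by apply/measurable_EFinP; exact: measurable_tailw.
have n0 n : 0 < n.+1%:R :> R by rewrite ltr0n.
have [||_ _] := @dominated_convergence _ _ _ mu setT measurableT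
  (fun n => EFin \o tailw n.+1%:R) (cst 0%E) (EFin \o weight) mt
  (measurable_cst _) _ iw _.
- apply: aeW => s _; apply: cvg_EFin; first exact: nearW.
  apply: (@squeeze_cvgr _ _ _ _ (cst 0) (fun n => weight s * `|s| * harmonic n)).
  + apply: nearW => n; rewrite tailw_ge0//= ler_wpM2l//.
      by rewrite mulr_ge0// ltW// weight_gt0.
    by rewrite lef_pV2 ?posrE ?tailden_gt0// lerDr.
  + exact: cvg_cst.
  + rewrite -(mulr0 (weight s * `|s|)).
    by apply: cvgM; [exact: cvg_cst|exact: cvg_harmonic].
- by apply: aeW => s n _; rewrite /= lee_fin ger0_norm ?tailw_ge0// tailw_le.
rewrite integral0 => /fine_cvg /cvgrPdist_le /(_ _ e0)[n _ /(_ n (leqnn n))].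
rewrite /= sub0r normrN => h; exists n.+1%:R; split => // y ny.
exact: le_trans (Rintegral_tailw_nincr (n0 n) ny) (le_trans (ler_norm _) h).
Qed.

Lemma integrable_reker x y : 0 < y -> integrable (reker x y).
Proof.
(* The dominating function is [weight / y], because [|u| y <= u^2 + y^2]. *)
move=> y0; have ik := integrable_lin y^-1 0 iw iw.
apply: (integrable_le (measurable_reker x y0) ik) => s.
rewrite mul0r addr0 /reker !normrM (ger0_norm (ltW (weight_gt0 _))) normfV.
rewrite (gtr0_norm (kerden_gt0 x s y0)) -mulrA [leRHS]mulrC ler_pM2l ?weight_gt0//.
rewrite ler_pdivrMr ?kerden_gt0// mulrC ler_pdivlMr//.
rewrite -(real_normK (num_real (s - x))); move: `|_| => u.
have := sqr_ge0 (u - y); nra.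
Qed.

(** The inequality [|u| <= e u^2 + 1 / (4 e)] with [u = s - x]. Its purpose is to bound the
    horizontal velocity by a small constant plus a multiple of the derivative of [ln y]. *)
Lemma abs_Rintegral_reker e x y : 0 < y -> 0 < e ->
  `|I (reker x y)| <= e * I weight + (4 * e)^-1 * I (imker x y).
Proof.
move=> y0 e0.
have ir := integrable_reker x y0; have ii := integrable_imker x y0.
have key s : `|s - x| / ((s - x) ^+ 2 + y ^+ 2) <=
    e + (4 * e)^-1 / ((s - x) ^+ 2 + y ^+ 2).
  rewrite ler_pdivrMr ?kerden_gt0// mulrDl divfK ?gt_eqF ?kerden_gt0//.
  rewrite -(real_normK (num_real (s - x))); move: `|_| => u.
  have e4 : 0 < 4 * e by rewrite mulr_gt0.
  rewrite -(ler_pM2l e4) [leRHS]mulrDr divff ?gt_eqF//.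
  have := sqr_ge0 (2 * e * u - 1); have := sqr_ge0 (e * y); nra.
have key2 s : `|reker x y s| <= e * weight s + (4 * e)^-1 * imker x y s.
  rewrite /reker /imker -mulrA normrM (gtr0_norm (weight_gt0 s)).
  rewrite normrM normfV (gtr0_norm (kerden_gt0 x s y0)).
  have := key s; rewrite -(ler_pM2l (weight_gt0 s)).
  by rewrite mulrDr => /le_trans; apply; lra.
have h1 := @Rintegral_lin4_le0 1 (- e) (- (4 * e)^-1) 0 _ _ _ _ ir iw ii ii.
have h2 := @Rintegral_lin4_le0 (-1) (- e) (- (4 * e)^-1) 0 _ _ _ _ ir iw ii ii.
rewrite ler_norml; apply/andP; split.
  suff : -1 * I (reker x y) + - e * I weight +
    (- (4 * e)^-1 * I (imker x y) + 0 * I (imker x y)) <= 0 by lra.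
  by apply: h2 => s; have := key2 s; rewrite ler_norml => /andP[? ?]; lra.
suff : 1 * I (reker x y) + - e * I weight +
  (- (4 * e)^-1 * I (imker x y) + 0 * I (imker x y)) <= 0 by lra.
by apply: h1 => s; have := key2 s; rewrite ler_norml => /andP[? ?]; lra.
Qed.

(* Infinitesimal Schwarz--Pick: the integrand is
   [- weight s * |z - w|^2 * |1 / (s - z) - 1 / (s - w^* )|^2]. *)
Lemma schwarz_pick_generator x y x' y' : 0 < y -> 0 < y' ->
  2 * (x - x') * (I (reker x y) - I (reker x' y')) +
  2 * (y - y') * (y * I (imker x y) - y' * I (imker x' y')) <=
  ((x - x') ^+ 2 + (y - y') ^+ 2) * (I (imker x y) + I (imker x' y')).
Proof.
move=> y0 y'0; pose N := (x - x') ^+ 2 + (y - y') ^+ 2.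
rewrite -/N.
have h := @Rintegral_lin4_le0 (2 * (x - x')) (- (2 * (x - x')))
  (2 * (y - y') * y - N) (- (2 * (y - y') * y') - N) _ _ _ _
  (integrable_reker x y0) (integrable_reker x' y'0)
  (integrable_imker x y0) (integrable_imker x' y'0).
rewrite -subr_le0.
have {}h := h _.
suff : forall s, 2 * (x - x') * reker x y s + - (2 * (x - x')) * reker x' y' s +
  ((2 * (y - y') * y - N) * imker x y s +
   (- (2 * (y - y') * y') - N) * imker x' y' s) <= 0 by move=> /h ?; lra.
move=> s; rewrite /reker /imker.
have d0 := kerden_gt0 x s y0; have d'0 := kerden_gt0 x' s y'0.
set X := (X in X <= 0).
have -> : X = - (weight s * N * ((x - x') ^+ 2 + (y + y') ^+ 2) /
  (((s - x) ^+ 2 + y ^+ 2) * ((s - x') ^+ 2 + y' ^+ 2))).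
  by rewrite /X /N; field; rewrite !gt_eqF.
by rewrite oppr_le0 divr_ge0 ?mulr_ge0 ?addr_ge0 ?sqr_ge0 ?ltW ?weight_gt0.
Qed.

(** With [M] the maximum of [|s - x|] and [y], the sector condition gives [|s| + y <= (C + 2) M], so
    [|a| (|s| + y) <= (C + 2) M^2]. It is used with [a = s - x] and [a = y]. *)
Lemma tail_bound C x y s a : 0 < y -> `|x| <= C * y -> 
   `|a| <= Num.max `|s - x| y ->
  `|weight s * s * a / ((s - x) ^+ 2 + y ^+ 2)| <= (C + 2) * tailw y s.
Proof.
move=> y0 xC au; have d0 := kerden_gt0 x s y0; have v0 := tailden_gt0 s y0.
have C0 : 0 <= C by rewrite -(pmulr_lge0 _ y0) (le_trans _ xC).
have key : `|a| * (`|s| + y) <= (C + 2) * ((s - x) ^+ 2 + y ^+ 2).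
  have sx : `|s| <= `|s - x| + C * y.
    by rewrite -[in leLHS](subrK x s) (le_trans (ler_normD _ _))// lerD2l.
  rewrite -(real_normK (num_real (s - x))).
  move: sx au; have := normr_ge0 (s - x); have := normr_ge0 a.
  move: (`|s - x|) (`|s|) (`|a|) => u v b b0 u0 vu.
  have yC : 0 <= C * (u - y) ^+ 2 by rewrite mulr_ge0 ?sqr_ge0.
  have yu : 0 <= C * u ^+ 2 by rewrite mulr_ge0 ?sqr_ge0.
  have yy : 0 <= C * y ^+ 2 by rewrite mulr_ge0 ?sqr_ge0.
  have := sqr_ge0 (u - y) => sq.
  have h1 : b * (v + y) <= b * (u + (C + 1) * y) by rewrite ler_wpM2l//; lra.
  have Cy : 0 <= C * y by rewrite mulr_ge0// ltW.
  have uCy : 0 <= u + (C + 1) * y by lra.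
  have y2 := sqr_ge0 y; have u2 := sqr_ge0 u.
  rewrite le_max => /orP[bu|bu]; apply: (le_trans h1);
    apply: (le_trans (ler_wpM2r uCy bu)); lra.
rewrite normrM normfV (gtr0_norm d0) !normrM (gtr0_norm (weight_gt0 s)) /tailw.
have : `|a| / ((s - x) ^+ 2 + y ^+ 2) <= (C + 2) / (`|s| + y).
  by rewrite ler_pdivrMr// mulrAC ler_pdivlMr.
have ws0 : 0 <= weight s * `|s| by rewrite mulr_ge0// ltW// weight_gt0.
by move=> /(ler_wpM2l ws0) h; rewrite -mulrA [leRHS]mulrCA.
Qed.

(** Real part of [z / (s - z) + 1 = s / (s - z)], integrated against [weight]: half the velocity of
    [Re (z^2)] differs from [- I weight] by a tail integral. *)
Lemma square_derive_re C x y : 0 < y -> `|x| <= C * y ->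
  `|x * I (reker x y) - y ^+ 2 * I (imker x y) + I weight| <= (C + 2) * I (tailw y).
Proof.
move=> y0 xC.
have ir := integrable_reker x y0; have ii := integrable_imker x y0.
have it := integrable_tailw y0.
have key s : `|x * reker x y s - y ^+ 2 * imker x y s + weight s| <= (C + 2) * tailw y s.
  have := @tail_bound C x y s (s - x) y0 xC.
  rewrite le_max lexx => /(_ isT); congr (`|_| <= _).
  by rewrite /reker /imker; field; rewrite gt_eqF ?kerden_gt0.
have h1 := @Rintegral_lin4_le0 x (- y ^+ 2) 1 (- (C + 2)) _ _ _ _ ir ii iw it.
have h2 := @Rintegral_lin4_le0 (- x) (y ^+ 2) (-1) (- (C + 2)) _ _ _ _ ir ii iw it.
rewrite ler_norml; apply/andP; split.
  rewrite -subr_le0; have {}h2 := h2 _; apply: le_trans (h2 _); first by lra.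
  by move=> s; have := key s; rewrite ler_norml => /andP[? ?]; lra.
rewrite -subr_le0; apply: le_trans (h1 _); first by lra.
by move=> s; have := key s; rewrite ler_norml => /andP[? ?]; lra.
Qed.

(** Imaginary part of the same identity, where the summand [1] disappears. *)
Lemma square_derive_im C x y : 0 < y -> `|x| <= C * y ->
  `|x * (y * I (imker x y)) + y * I (reker x y)| <= (C + 2) * I (tailw y).
Proof.
move=> y0 xC.
have ir := integrable_reker x y0; have ii := integrable_imker x y0.
have it := integrable_tailw y0.
have key s : `|x * y * imker x y s + y * reker x y s| <= (C + 2) * tailw y s.
  have := @tail_bound C x y s y y0 xC.
  rewrite le_max (gtr0_norm y0) lexx orbT => /(_ isT); congr (`|_| <= _).
  by rewrite /reker /imker; field; rewrite gt_eqF ?kerden_gt0.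
have h1 := @Rintegral_lin4_le0 (x * y) y (- (C + 2)) 0 _ _ _ _ ii ir it it.
have h2 := @Rintegral_lin4_le0 (- (x * y)) (- y) (- (C + 2)) 0 _ _ _ _ ii ir it it.
rewrite ler_norml; apply/andP; split.
  rewrite -subr_le0; apply: le_trans (h2 _); first by lra.
  by move=> s; have := key s; rewrite ler_norml => /andP[? ?]; lra.
rewrite -subr_le0; apply: le_trans (h1 _); first by lra.
by move=> s; have := key s; rewrite ler_norml => /andP[? ?]; lra.
Qed.

End FiniteSecondMoment.
End HerglotzIntegrals.

(** * Complex limits, derivatives and the generator in real coordinates *)

Section ComplexBridge.
Set Implicit Arguments.
Unset Strict Implicit.
Context {R : realType}.
Local Notation Re := complex.Re.
Local Notation Im := complex.Im.
Implicit Types (z w l : CC R) (s t : R).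

Lemma ReD z w : Re (z + w) = Re z + Re w.
Proof. by case: z w => [a b] [c d]. Qed.

Lemma ImD z w : Im (z + w) = Im z + Im w.
Proof. by case: z w => [a b] [c d]. Qed.

Lemma ReB z w : Re (z - w) = Re z - Re w.
Proof. by case: z w => [a b] [c d]. Qed.

Lemma ImB z w : Im (z - w) = Im z - Im w.
Proof. by case: z w => [a b] [c d]. Qed.

Lemma ReZ s z : Re ((s%:C)%C * z) = s * Re z.
Proof. by case: z => [a b] /=; rewrite mul0r subr0. Qed.

Lemma ImZ s z : Im ((s%:C)%C * z) = s * Im z.
Proof. by case: z => [a b] /=; rewrite mul0r addr0. Qed.

Lemma div_real z s : z / (s%:C)%C = (s^-1%:C)%C * z.
Proof. by rewrite mulrC -fmorphV. Qed.

Lemma normCC_cmod z : `|z| = (cmod z)%:C%C.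
Proof. exact: normc_def. Qed.

Lemma cmod_sq z : cmod z ^+ 2 = Re z ^+ 2 + Im z ^+ 2.
Proof. by rewrite sqr_sqrtr// addr_ge0// sqr_ge0. Qed.

Lemma absRe_le_cmod z : `|Re z| <= cmod z.
Proof. by rewrite -sqrtr_sqr ler_wsqrtr// lerDl sqr_ge0. Qed.

Lemma absIm_le_cmod z : `|Im z| <= cmod z.
Proof. by rewrite -sqrtr_sqr ler_wsqrtr// lerDr sqr_ge0. Qed.

Lemma cmod_le_Re_Im z : cmod z <= `|Re z| + `|Im z|.
Proof.
have h : 0 <= `|Re z| + `|Im z| by rewrite addr_ge0.
rewrite -(ler_pXn2r (ltn0Sn 1)) ?nnegrE ?sqrtr_ge0// cmod_sq.
rewrite -(real_normK (num_real (Re z))) -(real_normK (num_real (Im z))).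
have := normr_ge0 (Re z); have := normr_ge0 (Im z).
by move: `|_| `|_| => u v *; nra.
Qed.

Section Limits.
Context {T : Type} {F : set_system T} {FF : Filter F}.
Implicit Types f : T -> CC R.

Lemma cvg_Re f l : f t @[t --> F] --> l -> Re (f t) @[t --> F] --> Re l.
Proof.
move=> fl; apply/cvgrPdist_lt => e e0.
have eC : 0 < (e%:C)%C :> R[i] by rewrite ltcR.
move/cvgrPdist_lt: fl => /(_ _ eC); apply: filterS => t.
rewrite normCC_cmod ltcR; apply: le_lt_trans.
by rewrite -ReB absRe_le_cmod.
Qed.

Lemma cvg_Im f l : f t @[t --> F] --> l -> Im (f t) @[t --> F] --> Im l.
Proof.
move=> fl; apply/cvgrPdist_lt => e e0.
have eC : 0 < (e%:C)%C :> R[i] by rewrite ltcR.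
move/cvgrPdist_lt: fl => /(_ _ eC); apply: filterS => t.
rewrite normCC_cmod ltcR; apply: le_lt_trans.
by rewrite -ImB absIm_le_cmod.
Qed.

Lemma cvg_Complex f l : Re (f t) @[t --> F] --> Re l ->
  Im (f t) @[t --> F] --> Im l -> f t @[t --> F] --> l.
Proof.
move=> fr fi; apply/cvgrPdist_lt => -[e e'].
(* The radius is a complex number here; positivity forces its imaginary part to vanish. *)
rewrite ltcE/= => /andP[/eqP -> e0].
have e2 : 0 < e / 2 by rewrite divr_gt0.
move/cvgrPdist_lt: fr => /(_ _ e2) fr; move/cvgrPdist_lt: fi => /(_ _ e2) fi.
near=> t.
rewrite normCC_cmod ltcR (le_lt_trans (cmod_le_Re_Im _))// ReB ImB.
rewrite (splitr e) ltrD//; near: t; [exact: fr|exact: fi].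
Unshelve. all: by end_near. Qed.
End Limits.

(** [(1 + s z) / (s - z) = - s + (1 + s^2) / (s - z)]. *)
Lemma ReIm_herglotz_kernel s z : UHP z ->
  Re ((1 + (s%:C)%C * z) / ((s%:C)%C - z)) = - s + reker (Re z) (Im z) s /\
  Im ((1 + (s%:C)%C * z) / ((s%:C)%C - z)) = Im z * imker (Re z) (Im z) s.
Proof.
case: z => x y; rewrite /UHP/= => y0.
have d0 := kerden_gt0 x s y0.
have d1 : (s - x) ^+ 2 + (0 - y) ^+ 2 != 0 by rewrite sub0r sqrrN gt_eqF.
rewrite /reker /imker /weight; split; field; rewrite ?gt_eqF//.
Qed.

Section Generator.
Variables (phi : R -> CC R -> CC R) (G : CC R -> CC R).
Hypothesis gen : infinitesimal_generator phi G.

(** For [t > 0] the constraint [0 <= t + h] holds for all small [h], so the limit is two-sided.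
    Orbits are therefore differentiated at positive times only. *)
Lemma generator_cvg_dnbhs t z : 0 < t -> UHP z ->
  (phi (t + h) z - phi t z) / (h%:C)%C @[h --> 0^'] --> G (phi t z).
Proof.
move=> t0 zH; have [_ _ /(_ t (ltW t0) z zH)] := gen.
apply: cvg_trans; apply: cvg_app => A wA.
have tnear : \forall h \near (0 : R), 0 <= t + h.
  apply/nbhs_ballP; exists t => //= h.
  rewrite /ball/= sub0r normrN ltr_norml => /andP[? _]; lra.
have {}wA : \forall h \near (0 : R), h != 0 /\ 0 <= t + h -> A h by [].
suff : \forall h \near (0 : R), h != 0 -> A h by [].
by apply: filterS2 wA tnear => h hA th h0; exact: hA.
Qed.

Lemma is_derive_Re t z : 0 < t -> UHP z ->
  is_derive t 1 (fun u => Re (phi u z)) (Re (G (phi t z))).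
Proof.
move=> t0 zH; have /cvg_Re h := generator_cvg_dnbhs t0 zH.
have {}h : h^-1 *: (((fun u => Re (phi u z)) \o shift t) (h *: (1 : R)) -
    Re (phi t z)) @[h --> 0^'] --> Re (G (phi t z)).
  move: h; apply: cvg_trans; apply: near_eq_cvg; apply: nearW => h /=.
  by rewrite div_real ReZ ReB /GRing.scale/= mulr1 [h + t]addrC.
by split; [apply/cvg_ex; eexists; exact: h|exact: cvg_lim h].
Qed.

Lemma is_derive_Im t z : 0 < t -> UHP z ->
  is_derive t 1 (fun u => Im (phi u z)) (Im (G (phi t z))).
Proof.
move=> t0 zH; have /cvg_Im h := generator_cvg_dnbhs t0 zH.
have {}h : h^-1 *: (((fun u => Im (phi u z)) \o shift t) (h *: (1 : R)) -
    Im (phi t z)) @[h --> 0^'] --> Im (G (phi t z)).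
  move: h; apply: cvg_trans; apply: near_eq_cvg; apply: nearW => h /=.
  by rewrite div_real ImZ ImB /GRing.scale/= mulr1 [h + t]addrC.
by split; [apply/cvg_ex; eexists; exact: h|exact: cvg_lim h].
Qed.
End Generator.

Section Herglotz.
Variables (G : CC R -> CC R) (alpha beta : R).
Variable mu : {finite_measure set R -> \bar R}.
Hypothesis Grepr : herglotz_repr G alpha beta mu.
Local Notation I f := (Rintegral mu setT f).

(** For fixed [z] the imaginary part of the kernel is bounded in [s], so this formula is available
    before any moment of [mu] is known to be finite. *)
Lemma Im_herglotz z : UHP z ->
  Im (G z) = Im z * (alpha + I (imker (Re z) (Im z))).
Proof.
move=> zH; rewrite Grepr// !ImD ImZ /= addr0 mulrDr mulrC; congr (_ + _).
rewrite -RintegralZl//; last exact: integrable_imker.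
by apply: eq_Rintegral => s _; have [_ ->] := ReIm_herglotz_kernel s zH.
Qed.

(** Integrating the term [- s] of the kernel separately requires a finite first moment, which
    [weight] provides. *)
Lemma Re_herglotz z : UHP z -> mu.-integrable setT (EFin \o @weight R) ->
  Re (G z) = alpha * Re z + (beta - I (fun s => s)) + I (reker (Re z) (Im z)).
Proof.
move=> zH iw; rewrite Grepr// !ReD ReZ /= -!addrA; congr (_ + (_ + _)).
rewrite addrC -RintegralB//.
- apply: eq_Rintegral => s _.
  by have [-> _] := ReIm_herglotz_kernel s zH; rewrite addrC.
- exact: integrable_reker.
- exact: integrable_id.
Qed.
End Herglotz.
End ComplexBridge.

(** * Finite upper limits at infinity *)

Section LimSup.
Set Implicit Arguments.
Unset Strict Implicit.
Context {R : realType}.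
Implicit Types f : R -> R.

Lemma limf_esup_lty_bound f :
  (limf_esup (fun t => (f t)%:E) (+oo%R : set (set R)) < +oo)%E ->
  exists C T, forall t, T <= t -> f t <= C.
Proof.
move=> /ereal_inf_lt[_ [V [M [_ MV]] <-]] supV.
have M1 : M < M + 1 by rewrite ltrDl.
have ub t : M < t -> ((f t)%:E <= ereal_sup [set (f t)%:E | t in V])%E.
  by move=> Mt; apply: ereal_sup_ubound; exists t => //; exact: MV.
(* The supremum is not [+oo] by assumption, nor [-oo], since it dominates the real value at
   [M + 1]. *)
move: supV ub; case: ereal_sup => [C _ ub|//|_ ub].
  exists C, (M + 1) => t Mt; rewrite -lee_fin; apply: ub.
  exact: lt_le_trans Mt.
by have := ub _ M1; rewrite leeNy_eq.
Qed.

Lemma cvg_limf_esup_lty f (l : R) : f t @[t --> +oo] --> l ->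
  (limf_esup (fun t => (f t)%:E) (+oo%R : set (set R)) < +oo)%E.
Proof.
move=> fl.
have fV : \forall t \near +oo, f t < l + 1.
  by apply: (cvgr_lt _ fl); rewrite ltrDl.
apply: (@le_lt_trans _ _ (l + 1)%:E); last exact: ltry.
apply: (@le_trans _ _ (ereal_sup [set (f t)%:E | t in [set t | f t < l + 1]])).
  by apply: ereal_inf_lbound; exists [set t | f t < l + 1].
by apply: ge_ereal_sup => _ [t /= ft <-]; rewrite lee_fin ltW.
Qed.
End LimSup.

(** * Orbits as solutions of the differential equation *)

Section Orbits.
Set Implicit Arguments.
Unset Strict Implicit.
Context {R : realType}.
Local Notation Re := complex.Re.
Local Notation Im := complex.Im.
Variables (phi : R -> CC R -> CC R) (G : CC R -> CC R) (alpha beta : R).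
Variable mu : {finite_measure set R -> \bar R}.
Hypothesis sg : semigroup_H phi.
Hypothesis gen : infinitesimal_generator phi G.
Hypothesis Grepr : herglotz_repr G alpha beta mu.
Hypothesis alpha_ge0 : 0 <= alpha.
Implicit Types (z w : CC R) (s t C T : R).
Local Notation I f := (Rintegral mu setT f).
Local Notation X z t := (Re (phi t z)).
Local Notation Y z t := (Im (phi t z)).
Local Notation P z t := (I (imker (X z t) (Y z t))).
Local Notation Q z t := (I (reker (X z t) (Y z t))).

Lemma orbit_UHP z t : 0 <= t -> UHP z -> UHP (phi t z).
Proof. by move=> t0 zH; have [/(_ t t0 z zH)[]] := sg. Qed.

Lemma orbit_Im_gt0 z t : 0 < t -> UHP z -> 0 < Y z t.
Proof. by move=> /ltW t0 zH; exact: orbit_UHP. Qed.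

Lemma is_derive_orbit_Im z t : 0 < t -> UHP z ->
  is_derive t 1 (fun u => Y z u) (Y z t * (alpha + P z t)).
Proof.
move=> t0 zH; have d := is_derive_Im gen t0 zH.
by rewrite -(Im_herglotz Grepr)//; exact: orbit_UHP (ltW t0) zH.
Qed.

Lemma imker_int_ge0 x y : 0 <= I (imker x y).
Proof. by apply: Rintegral_ge0 => s _; exact: imker_ge0. Qed.

Lemma orbit_Im_ndecr z s t : 0 < s -> s <= t -> UHP z -> Y z s <= Y z t.
Proof.
move=> s0 st zH; apply: (@is_derive_ge0_ndecr _ (fun u => Y z u)
  (fun u => Y z u * (alpha + P z u)) s t st) => u su _.
  by apply: is_derive_orbit_Im => //; exact: lt_le_trans su.
by rewrite mulr_ge0 ?addr_ge0 ?imker_int_ge0// ltW// orbit_Im_gt0// (lt_trans s0).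
Qed.

(** * Growth at most [C sqrt t] forces the conditions on [alpha], [beta] and [mu] *)

Section SlowOrbit.
Variables (z : CC R) (C T : R).
Hypotheses (zH : UHP z) (C0 : 0 < C) (T0 : 0 < T).
Hypothesis slow : forall t, T <= t -> cmod (phi t z) <= C * Num.sqrt t.

Let Y_slow t : T <= t -> Y z t <= C * Num.sqrt t.
Proof.
move=> Tt; rewrite (le_trans _ (slow Tt))// (le_trans _ (absIm_le_cmod _))//.
exact: ler_norm.
Qed.

(** If [alpha > 0], then [Y' / Y >= alpha >= 1 / t] once [t >= 1 / alpha]: growth exponent 1, above
    the admissible [1 / 2]. *)
Lemma slow_orbit_alpha0 : alpha = 0.
Proof.
apply/eqP; rewrite eq_le alpha_ge0 andbT leNgt; apply/negP => a0.
pose s := Num.max T alpha^-1.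
have Ts : T <= s by rewrite le_max lexx.
have as_ : alpha^-1 <= s by rewrite le_max lexx orbT.
have s0 : 0 < s := lt_le_trans T0 Ts.
suff : (1 : R) <= 1 / 2 by lra.
apply: (@sqrt_growth_exponent _ (fun t => Y z t)
    (fun t => Y z t * (alpha + P z t)) 1 C s s0) => t st.
- by apply: is_derive_orbit_Im => //; exact: lt_le_trans st.
- by apply: orbit_Im_gt0 => //; exact: lt_le_trans st.
- have t0 := lt_le_trans s0 st.
  rewrite mulrC ler_pM2l ?orbit_Im_gt0// div1r (@le_trans _ _ alpha)//.
    by rewrite invf_ple ?posrE// (le_trans as_).
  by rewrite lerDl imker_int_ge0.
- by apply: Y_slow; exact: le_trans st.
Qed.

(** Since [|phi_t z|^2 <= C^2 t], the kernel bound with [K = C^2 t] gives [Y' / Y >= k / t] for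
    [k = I (truncw n) / (2 C^2)], and [k <= 1 / 2]. The start [s] ensures [n + 1 <= C^2 t]. *)
Lemma slow_orbit_truncw n : I (truncw n) <= C ^+ 2.
Proof.
have C2 : 0 < C ^+ 2 by rewrite exprn_gt0.
pose s := Num.max T (n.+1%:R / C ^+ 2).
have Ts : T <= s by rewrite le_max lexx.
have ns : n.+1%:R / C ^+ 2 <= s by rewrite le_max lexx orbT.
have s0 : 0 < s := lt_le_trans T0 Ts.
suff : I (truncw n) / (2 * C ^+ 2) <= 1 / 2.
  by rewrite ler_pdivrMr ?mulr_gt0// => ?; lra.
apply: (@sqrt_growth_exponent _ (fun t => Y z t)
    (fun t => Y z t * (alpha + P z t)) _ C s s0) => t st.
- by apply: is_derive_orbit_Im => //; exact: lt_le_trans st.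
- by apply: orbit_Im_gt0 => //; exact: lt_le_trans st.
- have t0 := lt_le_trans s0 st.
  rewrite mulrC ler_pM2l ?orbit_Im_gt0// ler_wpDl//.
  have := @Rintegral_imker_ge _ mu n (C ^+ 2 * t) (X z t) (Y z t) (orbit_Im_gt0 t0 zH).
  have h1 : n.+1%:R <= C ^+ 2 * t.
    by rewrite mulrC -ler_pdivrMr// (le_trans ns).
  have h2 : X z t ^+ 2 + Y z t ^+ 2 <= C ^+ 2 * t.
    rewrite -cmod_sq -[in leRHS](sqr_sqrtr (ltW t0)) -exprMn.
    rewrite ler_pXn2r ?nnegrE ?mulr_ge0 ?sqrtr_ge0 ?(ltW C0)//.
    by apply: slow; exact: le_trans st.
  move=> /(_ h1 h2) h.
  rewrite -mulrA -invfM ler_pdivrMr ?mulr_gt0//.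
  by apply: (le_trans h); rewrite le_eqVlt; apply/orP; left; apply/eqP; ring.
- by apply: Y_slow; exact: le_trans st.
Qed.

Lemma slow_orbit_integrable_weight : mu.-integrable setT (EFin \o @weight R).
Proof. exact: integrable_weight_of_truncw slow_orbit_truncw. Qed.

(* The orbit moves horizontally at speed [b], up to an error
   [e * m * t + ln Y / (4 * e)] which is small compared with [t]. *)
Lemma slow_orbit_drift_le (sgn e : R) : `|sgn| = 1 -> 0 < e ->
  sgn * (beta - I (fun s => s)) <= e * I (@weight R).
Proof.
move=> sgn1 e0; have iw := slow_orbit_integrable_weight.
have a0 := slow_orbit_alpha0.
pose b := beta - I (fun s => s); pose m := I (@weight R); rewrite -/b -/m.
pose k : R := (4 * e)^-1.
have k0 : 0 < k by rewrite invr_gt0 mulr_gt0.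
(* Nondecreasing: the horizontal velocity is [b + Q] with [|Q| <= e m + k P], and [P] is the
   derivative of [ln Y]. *)
pose F t := sgn * X z t - (sgn * b - e * m) * t + k * ln (Y z t).
rewrite -subr_le0.
apply: (@linear_le_sqrt _ _ ((1 + k) * C) (- F T) T) => t Tt.
have t0 := lt_le_trans T0 Tt.
have FT : F T <= F t.
  apply: (@is_derive_ge0_ndecr _ F
    (fun t => sgn * (b + Q z t) - (sgn * b - e * m) + k * P z t) T t Tt) => u Tu _.
    have u0 : 0 < u := lt_le_trans T0 Tu.
    have uH := orbit_UHP (ltW u0) zH.
    have dX := is_derive_Re gen u0 zH.
    rewrite (Re_herglotz Grepr uH iw) a0 mul0r add0r -/b in dX.
    have dY := is_derive_orbit_Im u0 zH.
    have dL := is_derive_ln_comp (orbit_Im_gt0 u0 zH) dY.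
    rewrite mulrC mulKf ?gt_eqF ?orbit_Im_gt0// in dL.
    by apply: is_derive_eq; rewrite /GRing.scale/= a0; ring.
  have u0 : 0 < u := lt_trans T0 Tu.
  have := @abs_Rintegral_reker _ mu iw e (X z u) (Y z u) (orbit_Im_gt0 u0 zH) e0.
  have := ler_norm (- (sgn * Q z u)); rewrite normrN normrM sgn1 mul1r.
  by rewrite -/m -/k => *; lra.
have hX : sgn * X z t <= C * Num.sqrt t.
  apply: (le_trans (ler_norm _)); rewrite normrM sgn1 mul1r.
  exact: le_trans (absRe_le_cmod _) (slow Tt).
(* The crude bound [ln Y < Y] suffices, as [sqrt t] is already negligible against [t]. *)
have hY : k * ln (Y z t) <= k * (C * Num.sqrt t).
  rewrite ler_pM2l// (le_trans (ltW (ln_sublinear (orbit_Im_gt0 t0 zH))))//.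
  exact: Y_slow.
rewrite /F in FT *; lra.
Qed.

Lemma slow_orbit_drift0 : beta = I (fun s => s).
Proof.
apply/eqP; rewrite -subr_eq0 -normr_eq0; apply/eqP/le_anti.
rewrite normr_ge0 andbT leNgt; apply/negP => b0.
set b := beta - _ in b0.
have m0 : 0 <= I (@weight R).
  by apply: Rintegral_ge0 => s _; exact: ltW (weight_gt0 s).
(* Makes [e * I weight < |b|]; the [+ 1] covers a vanishing integral. *)
pose e := `|b| / (2 * (I (@weight R) + 1)).
have d0 : 0 < 2 * (I (@weight R) + 1) by rewrite mulr_gt0// ltr_wpDl.
have e0 : 0 < e by rewrite divr_gt0.
have : `|b| <= e * I (@weight R).
  have [b0'|b0'] := leP 0 b.
    by rewrite ger0_norm// -[b]mul1r slow_orbit_drift_le// normr1.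
  by rewrite ltr0_norm// -mulN1r slow_orbit_drift_le// normrN1.
rewrite /e mulrAC ler_pdivlMr// leNgt => /negP; apply.
have : 0 <= `|b| * I (@weight R) by rewrite mulr_ge0.
lra.
Qed.
End SlowOrbit.

(** * Asymptotics of orbits when [G z] is the integral of [weight s / (s - z)] *)

Section DriftFree.
Hypothesis alpha0 : alpha = 0.
Hypothesis iw : mu.-integrable setT (EFin \o @weight R).
Hypothesis beta_eq : beta = I (fun s => s).
Local Notation m := (I (@weight R)).

Lemma is_derive_driftfree_Re z t : 0 < t -> UHP z ->
  is_derive t 1 (fun u => X z u) (Q z t).
Proof.
move=> t0 zH; have d := is_derive_Re gen t0 zH.
have := Re_herglotz Grepr (orbit_UHP (ltW t0) zH) iw.
by rewrite alpha0 mul0r add0r beta_eq subrr add0r => <-.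
Qed.

Lemma is_derive_driftfree_Im z t : 0 < t -> UHP z ->
  is_derive t 1 (fun u => Y z u) (Y z t * P z t).
Proof.
by move=> t0 zH; have := is_derive_orbit_Im t0 zH; rewrite alpha0 add0r.
Qed.

(** If [m = 0], both velocity components vanish, the orbit of [i] is constant from time 1 to time 2,
    and [phi 1] fixes the point [phi 1 i]. *)
Lemma weight_int_gt0 : non_elliptic phi -> 0 < m.
Proof.
move=> ne; rewrite lt_neqAle; apply/andP; split; last first.
  by apply: Rintegral_ge0 => s _; exact: ltW (weight_gt0 s).
apply/eqP => m0.
pose z : CC R := Complex 0 1.
have zH : UHP z by rewrite /UHP/=.
have P0 t : 0 < t -> P z t = 0.
  move=> t0; apply/eqP; rewrite eq_le imker_int_ge0 andbT.
  by have := Rintegral_imker_le iw (X z t) (orbit_Im_gt0 t0 zH); rewrite -m0 mul0r.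
have Q0 t : 0 < t -> Q z t = 0.
  move=> t0; apply/eqP; rewrite -normr_le0.
  have := abs_Rintegral_reker iw (X z t) (orbit_Im_gt0 t0 zH) ltr01.
  by rewrite -m0 P0// !mulr0 addr0.
have l12 : (1 : R) <= 1 + 1 by rewrite lerDl.
have t0 (u : R) : 1 <= u -> 0 < u by exact: lt_le_trans.
have X12 : X z (1 + 1) = X z 1.
  apply/eqP; rewrite eq_le; apply/andP; split.
    apply: (@is_derive_le0_nincr _ (fun t => X z t) (fun t => Q z t) _ _ l12) => u u1 _.
      exact: is_derive_driftfree_Re (t0 _ u1) zH.
    by rewrite Q0// t0// ltW.
  apply: (@is_derive_ge0_ndecr _ (fun t => X z t) (fun t => Q z t) _ _ l12) => u u1 _.
    exact: is_derive_driftfree_Re (t0 _ u1) zH.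
  by rewrite Q0// t0// ltW.
have Y12 : Y z (1 + 1) = Y z 1.
  apply/eqP; rewrite eq_le; apply/andP; split; last exact: orbit_Im_ndecr.
  apply: (@is_derive_le0_nincr _ (fun t => Y z t) (fun t => Y z t * P z t)
    _ _ l12) => u u1 _.
    exact: is_derive_driftfree_Im (t0 _ u1) zH.
  by rewrite P0 ?mulr0// t0// ltW.
have [_ _ add _] := sg.
apply: (ne 1 ltr01 _ (orbit_UHP ler01 zH)).
rewrite -add//; move: X12 Y12.
by case: (phi (1 + 1) z) => a b; case: (phi 1 z) => c d /= -> ->.
Qed.

(** [sqRe] and [sqIm] are the coordinates of the squared orbit, whose velocity tends to the constant
    [- 2 m]. *)
Definition sqRe z t := X z t ^+ 2 - Y z t ^+ 2.
Definition sqIm z t := 2 * (X z t * Y z t).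

Lemma is_derive_sqRe z t : 0 < t -> UHP z ->
  is_derive t 1 (sqRe z) (2 * (X z t * Q z t - Y z t ^+ 2 * P z t)).
Proof.
move=> t0 zH; have dX := is_derive_driftfree_Re t0 zH.
have dY := is_derive_driftfree_Im t0 zH.
rewrite /sqRe; apply: is_derive_eq; rewrite /GRing.scale/=; ring.
Qed.

Lemma is_derive_sqIm z t : 0 < t -> UHP z ->
  is_derive t 1 (sqIm z) (2 * (X z t * (Y z t * P z t) + Y z t * Q z t)).
Proof.
move=> t0 zH; have dX := is_derive_driftfree_Re t0 zH.
have dY := is_derive_driftfree_Im t0 zH.
rewrite /sqIm; apply: is_derive_eq; rewrite /GRing.scale/=; ring.
Qed.

(** High in the sector the tail error is below [m], so [sqRe] cannot increase while it is negative;
    as heights never decrease, the barrier lemma traps the orbit. *)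
Lemma exists_orbit_in_sector : 0 < m ->
  exists w, UHP w /\ exists2 s, 0 < s & forall t, s <= t -> `|X w t| <= Y w t.
Proof.
(* The sector constant is [C = 1], so the error factor [C + 2] equals 3. *)
move=> m0; have m3 : 0 < m / 3 by rewrite divr_gt0.
have [M [M0 tailM]] := Rintegral_tailw_small iw m3.
pose w : CC R := Complex 0 (M + 1).
have wH : UHP w by rewrite /UHP/= ltr_wpDl// ltW.
exists w; split => //.
have [_ _ _ /(_ w wH) w0] := sg.
have Xw : X w t @[t --> 0^'+] --> (0 : R) by exact: (cvg_Re w0).
have Yw : Y w t @[t --> 0^'+] --> M + 1 by exact: (cvg_Im w0).
(* The derivative is known only at positive times; continuity at 0 moves the start to a small
   [s > 0], still inside the sector and above height [M]. *)
have [s [s0 [Xs Ys]]] : exists s, 0 < s /\ `|X w s| < M /\ M < Y w s.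
  move/cvgrPdist_lt: Xw => /(_ _ M0) nX.
  have nY : \forall t \near 0^'+, M < Y w t.
    by apply: (cvgr_gt _ Yw); rewrite ltrDl.
  near (0 : R)^'+ => s; exists s; split => //; split; near: s => //.
  by apply: filterS nX => s; rewrite sub0r normrN.
exists s => // t st.
have YM u : s <= u -> M < Y w u.
  by move=> su; apply: lt_le_trans Ys (orbit_Im_ndecr s0 su wH).
have neg : sqRe w t < 0.
  apply: (@lt0_barrier _ (sqRe w)
    (fun t => 2 * (X w t * Q w t - Y w t ^+ 2 * P w t)) s) => // [u su|u su|].
  - exact: is_derive_sqRe (lt_le_trans s0 su) wH.
  - rewrite /sqRe subr_lt0 => XY.
    have y0 := orbit_Im_gt0 (lt_le_trans s0 su) wH.
    have XYu : `|X w u| <= 1 * Y w u.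
      rewrite mul1r -(ler_pXn2r (ltn0Sn 1)) ?nnegrE ?(ltW y0)//.
      by rewrite real_normK ?num_real// ltW.
    have := square_derive_re iw y0 XYu; rewrite ler_norml => /andP[_ h1].
    have := tailM _ (ltW (YM u su)) => h2.
    lra.
  - rewrite /sqRe subr_lt0 -(real_normK (num_real (X w s))).
    have := normr_ge0 (X w s); nra.
have y0 := orbit_Im_gt0 (lt_le_trans s0 st) wH.
rewrite -(ler_pXn2r (ltn0Sn 1)) ?nnegrE ?(ltW y0)//.
by rewrite real_normK ?num_real// -subr_le0 ltW.
Unshelve. all: by end_near. Qed.

(* [|z - w|^2 / (Im z * Im w)] is a monotone function of the hyperbolic distance. *)
Lemma hyperbolic_quotient_nincr z w s t : UHP z -> UHP w -> 0 < s -> s <= t ->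
  ((X z t - X w t) ^+ 2 + (Y z t - Y w t) ^+ 2) / (Y z t * Y w t) <=
  ((X z s - X w s) ^+ 2 + (Y z s - Y w s) ^+ 2) / (Y z s * Y w s).
Proof.
move=> zH wH s0 st.
pose N u := (X z u - X w u) ^+ 2 + (Y z u - Y w u) ^+ 2.
pose dN u := 2 * (X z u - X w u) * (Q z u - Q w u) +
  2 * (Y z u - Y w u) * (Y z u * P z u - Y w u * P w u).
apply: (@is_derive_le0_nincr _
  (fun u => ((X z u - X w u) ^+ 2 + (Y z u - Y w u) ^+ 2) / (Y z u * Y w u))
  (fun u => (dN u - N u * (P z u + P w u)) / (Y z u * Y w u)) s t st) => u su _.
  have u0 := lt_le_trans s0 su.
  have dXz := is_derive_driftfree_Re u0 zH; have dYz := is_derive_driftfree_Im u0 zH.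
  have dXw := is_derive_driftfree_Re u0 wH; have dYw := is_derive_driftfree_Im u0 wH.
  have yz := orbit_Im_gt0 u0 zH; have yw := orbit_Im_gt0 u0 wH.
  (* The denominator has logarithmic derivative [P z + P w], the factor on the right of
     [schwarz_pick_generator]. *)
  have dYY : is_derive u 1 (fun u => Y z u * Y w u)
      (Y z u * Y w u * (P z u + P w u)).
    by apply: is_derive_eq; rewrite /GRing.scale/=; ring.
  have YY0 : Y z u * Y w u != 0 by rewrite gt_eqF// mulr_gt0.
  have dV := @is_deriveV _ (fun u => Y z u * Y w u) u _ 1 YY0 dYY.
  have dNu : is_derive u 1 N (dN u).
    by rewrite /N /dN; apply: is_derive_eq; rewrite /GRing.scale/=; ring.
  apply: is_derive_eq; rewrite /GRing.scale/= -/(N u) /dN.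
  by field; rewrite !gt_eqF.
have u0 := lt_trans s0 su.
have yz := orbit_Im_gt0 u0 zH; have yw := orbit_Im_gt0 u0 wH.
rewrite ler_pdivrMr ?mulr_gt0// mul0r subr_le0.
exact: schwarz_pick_generator.
Qed.

(** The orbit is compared with one in the sector: the hyperbolic quotient stays below its value [K]
    at time [s], which makes heights comparable and the horizontal gap at most a multiple of the
    height. *)
Lemma orbit_nontangential z : 0 < m -> UHP z ->
  exists C s, [/\ 0 <= C, 0 < s & forall t, s <= t -> `|X z t| <= C * Y z t].
Proof.
move=> m0 zH; have [w [wH [s s0 sector]]] := exists_orbit_in_sector m0.
pose K := ((X z s - X w s) ^+ 2 + (Y z s - Y w s) ^+ 2) / (Y z s * Y w s).
have K0 : 0 <= K.
  rewrite divr_ge0 ?addr_ge0 ?sqr_ge0// ltW// mulr_gt0 ?orbit_Im_gt0//.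
exists (2 * (K + 2)), s; split => // [|t st]; first by lra.
have t0 := lt_le_trans s0 st.
have yz := orbit_Im_gt0 t0 zH; have yw := orbit_Im_gt0 t0 wH.
have := hyperbolic_quotient_nincr zH wH s0 st; rewrite -/K.
have := sector t st.
rewrite ler_pdivrMr ?mulr_gt0//.
move: (X z t) (X w t) (Y z t) (Y w t) yz yw => x x' y y' y0 y'0 x'y' h.
(* [(y - y')^2 <= K y y'] gives [y'^2 <= (K + 2) y y']. *)
have y'y : y' <= (K + 2) * y.
  rewrite -(ler_pM2r y'0).
  have := sqr_ge0 (x - x'); have := sqr_ge0 y; nra.
(* [(x - x')^2 <= K y y' <= K (K + 2) y^2]. *)
have xx : `|x - x'| <= (K + 2) * y.
  have Ky : 0 <= (K + 2) * y by apply: mulr_ge0; [lra|exact: ltW].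
  rewrite -(ler_pXn2r (ltn0Sn 1)) ?nnegrE// real_normK ?num_real//.
  have h1 : K * (y * y') <= K * (y * ((K + 2) * y)) by rewrite !ler_wpM2l// ltW.
  have := sqr_ge0 (y - y'); have := mulr_ge0 K0 (sqr_ge0 y); have := sqr_ge0 y.
  lra.
rewrite -(subrK x' x) (le_trans (ler_normD _ _))//; lra.
Qed.

Lemma orbit_sq_asymptotics z : 0 < m -> UHP z -> DW_point_infty phi ->
  sqRe z t / t @[t --> +oo] --> - (2 * m) /\
  sqIm z t / t @[t --> +oo] --> 0.
Proof.
move=> m0 zH dw; have [C [s [C0 s0 nt]]] := orbit_nontangential m0 zH.
have tail (e : R) : 0 < e -> \forall t \near +oo, 0 < t /\ `|X z t| <= C * Y z t
    /\ (C + 2) * I (tailw (Y z t)) <= e.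
  move=> e0; have C2 : 0 < C + 2 by lra.
  have [M [M0 tailM]] := Rintegral_tailw_small iw (divr_gt0 e0 C2).
  (* In the sector the modulus is at most [(C + 1) Y], so a large modulus forces [Y >= M]. *)
  have cM : \forall t \near +oo, (C + 1) * M <= cmod (phi t z).
    exact: (cvgry_ge (dw z zH)).
  near=> t.
  have st : s <= t by near: t; apply: nbhs_pinfty_ge; rewrite num_real.
  have t0 := lt_le_trans s0 st; have y0 := orbit_Im_gt0 t0 zH.
  split => //; split; first exact: nt.
  rewrite mulrC -ler_pdivlMr//; apply: tailM.
  have : (C + 1) * M <= cmod (phi t z) by near: t.
  have C1 : 0 < C + 1 by lra.
  move=> /le_trans /(_ (cmod_le_Re_Im _)).
  move=> h; rewrite -(ler_pM2l C1); apply: (le_trans h).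
  by rewrite (gtr0_norm y0) mulrDl mul1r lerD2r nt.
split.
  apply: (is_derive_cvg_slope (g := fun t => 2 * (X z t * Q z t - Y z t ^+ 2 * P z t))).
    by move=> t t0; exact: is_derive_sqRe.
  apply/cvgrPdist_le => e e0; have e2 : 0 < e / 2 by rewrite divr_gt0.
  apply: filterS (tail _ e2) => t [t0 [xy te]].
  have := square_derive_re iw (orbit_Im_gt0 t0 zH) xy.
  by rewrite !ler_norml => /andP[? ?]; apply/andP; split; lra.
apply: (is_derive_cvg_slope
  (g := fun t => 2 * (X z t * (Y z t * P z t) + Y z t * Q z t))).
  by move=> t t0; exact: is_derive_sqIm.
apply/cvgrPdist_le => e e0; have e2 : 0 < e / 2 by rewrite divr_gt0.
apply: filterS (tail _ e2) => t [t0 [xy te]].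
have := square_derive_im iw (orbit_Im_gt0 t0 zH) xy.
by rewrite !ler_norml => /andP[? ?]; apply/andP; split; lra.
Unshelve. all: by end_near. Qed.

(** The modulus comes from [|z|^4 = sqRe^2 + sqIm^2]; then [Y^2 = (|z|^2 - sqRe) / 2] and
    [X^2 = |z|^2 - Y^2]. Positivity of [Y] selects the square root. *)
Lemma orbit_asymptotics z : 0 < m -> UHP z -> DW_point_infty phi ->
  [/\ X z t / Num.sqrt t @[t --> +oo] --> 0,
      Y z t / Num.sqrt t @[t --> +oo] --> Num.sqrt (2 * m) &
      cmod (phi t z) / Num.sqrt t @[t --> +oo] --> Num.sqrt (2 * m)].
Proof.
move=> m0 zH dw; have [hA hB] := orbit_sq_asymptotics m0 zH dw.
have sqrt_lim (f : R -> R) l : f t @[t --> +oo] --> l ->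
    Num.sqrt (f t) @[t --> +oo] --> Num.sqrt l.
  by move=> fl; apply: continuous_cvg => //; exact: sqrt_continuous.
have hN : (X z t ^+ 2 + Y z t ^+ 2) / t @[t --> +oo] --> 2 * m.
  have h : Num.sqrt (sqRe z t / t * (sqRe z t / t) + sqIm z t / t * (sqIm z t / t))
      @[t --> +oo] --> Num.sqrt (- (2 * m) * - (2 * m) + 0 * 0).
    by apply: sqrt_lim; apply: cvgD; apply: cvgM.
  move: h.
  rewrite mulr0 addr0 mulrNN -expr2 sqrtr_sqr ger0_norm ?mulr_ge0 ?ltW//.
  apply: cvg_trans; apply: near_eq_cvg; near=> t.
  have t0 : 0 < t by near: t; apply: nbhs_pinfty_gt; rewrite num_real.
  rewrite /sqRe /sqIm /=.
  have -> : forall a b : R, (a ^+ 2 - b ^+ 2) / t * ((a ^+ 2 - b ^+ 2) / t) +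
    (2 * (a * b)) / t * ((2 * (a * b)) / t) = ((a ^+ 2 + b ^+ 2) / t) ^+ 2.
    by move=> a b; field; rewrite gt_eqF.
  by rewrite sqrtr_sqr ger0_norm// divr_ge0 ?addr_ge0 ?sqr_ge0// ltW.
have hY : Y z t ^+ 2 / t @[t --> +oo] --> 2 * m.
  have : ((X z t ^+ 2 + Y z t ^+ 2) / t - sqRe z t / t) * 2^-1 @[t --> +oo]
      --> (2 * m - - (2 * m)) * 2^-1.
    by apply: cvgM; [exact: cvgB|exact: cvg_cst].
  have -> : (2 * m - - (2 * m)) * 2^-1 = 2 * m by field.
  apply: cvg_trans; apply: near_eq_cvg; apply: nearW => t.
  by rewrite /sqRe /=; lra.
have hX : X z t ^+ 2 / t @[t --> +oo] --> 0.
  have : (X z t ^+ 2 + Y z t ^+ 2) / t - Y z t ^+ 2 / t @[t --> +oo]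
      --> 2 * m - 2 * m by exact: cvgB.
  rewrite subrr.
  apply: cvg_trans; apply: near_eq_cvg; apply: nearW => t.
  by rewrite /=; lra.
have sqrt_div (a t : R) : 0 < t -> Num.sqrt (a ^+ 2 / t) = `|a| / Num.sqrt t.
  by move=> t0; rewrite sqrtrM ?sqr_ge0// sqrtr_sqr sqrtrV// ltW.
split.
(* The sign of [X] is lost in [X^2], which is harmless because the limit is 0. *)
- apply/norm_cvg0P; have := sqrt_lim _ _ hX; rewrite sqrtr0.
  apply: cvg_trans; apply: near_eq_cvg; near=> t.
  have t0 : 0 < t by near: t; apply: nbhs_pinfty_gt; rewrite num_real.
  have st0 : 0 <= (Num.sqrt t)^-1 by rewrite invr_ge0 sqrtr_ge0.
  by rewrite sqrt_div// normrM (ger0_norm st0).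
- have := sqrt_lim _ _ hY.
  apply: cvg_trans; apply: near_eq_cvg; near=> t.
  have t0 : 0 < t by near: t; apply: nbhs_pinfty_gt; rewrite num_real.
  by rewrite sqrt_div// gtr0_norm// orbit_Im_gt0.
- have := sqrt_lim _ _ hN.
  apply: cvg_trans; apply: near_eq_cvg; near=> t.
  have t0 : 0 < t by near: t; apply: nbhs_pinfty_gt; rewrite num_real.
  by rewrite -cmod_sq sqrt_div// ger0_norm// sqrtr_ge0.
Unshelve. all: by end_near. Qed.
End DriftFree.
End Orbits.

(** * The equivalences and the limit of [phi_t z / sqrt t] *)

Theorem theorem4p5 (R : realType) (phi : R -> CC R -> CC R)
  (G : CC R -> CC R) (alpha beta : R) (mu : {finite_measure set R -> \bar R}) :
  semigroup_H phi -> non_elliptic phi -> DW_point_infty phi ->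
  parabolic phi -> zero_hyperbolic_step phi ->
  infinitesimal_generator phi G ->
  0 <= alpha -> herglotz_repr G alpha beta mu ->
  let cond_b_some := exists z, UHP z /\
      (limf_esup (fun t : R => (cmod (phi t z) / Num.sqrt t)%:E) (+oo%R : set (set R)) < +oo)%E in
  let cond_b_all := forall z, UHP z ->
      (limf_esup (fun t : R => (cmod (phi t z) / Num.sqrt t)%:E) (+oo%R : set (set R)) < +oo)%E in
  let cond_c := [/\ alpha = 0,
                    (\int[mu]_s (s ^+ 2)%:E < +oo)%E &
                    (beta%:E = \int[mu]_s s%:E)%E] in
  [/\ extremal_rate phi <-> cond_b_some,
      cond_b_some <-> cond_b_all,
      extremal_rate phi <-> cond_c &
      (extremal_rate phi ->
        forall z, UHP z ->
          phi t z / ((Num.sqrt t)%:C)%C @[t --> +oo] -->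
          ('i%C * ((Num.sqrt (2 * fine (\int[mu]_s (1 + s ^+ 2)%:E)))%:C)%C
            : CC R))].
Proof.
move=> sg ne dw _ _ gen alpha_ge0 Grepr cond_b_some cond_b_all cond_c.
have iH : UHP ('i%C : CC R) by rewrite /UHP/=.
have c_drift_free : cond_c -> [/\ alpha = 0,
    mu.-integrable setT (EFin \o @weight R), beta = Rintegral mu setT (fun s => s)
    & 0 < Rintegral mu setT (@weight R)].
  move=> [a0 /integrable_weightP iw bE].
  have b_int : beta = Rintegral mu setT (fun s => s).
    by move: bE; rewrite (integral_id_EFin iw) => -[].
  split => //; exact: (weight_int_gt0 sg gen Grepr alpha_ge0 a0 iw b_int ne).
have b_c : cond_b_some -> cond_c.
  move=> [z [zH /limf_esup_lty_bound [C [T CT]]]].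
  (* The bound and the threshold from the upper limit may be nonpositive; both are raised to at
     least 1. *)
  have C1 : 0 < Num.max C 1 by rewrite lt_max ltr01 orbT.
  have T1 : 0 < Num.max T 1 by rewrite lt_max ltr01 orbT.
  have slow t : Num.max T 1 <= t ->
      cmod (phi t z) <= Num.max C 1 * Num.sqrt t.
    move=> Tt; have t0 := lt_le_trans T1 Tt.
    rewrite -ler_pdivrMr ?sqrtr_gt0// (@le_trans _ _ C) ?le_max ?lexx//.
    by apply: CT; apply: le_trans Tt; rewrite le_max lexx.
  have iw := slow_orbit_integrable_weight sg gen Grepr alpha_ge0 zH C1 T1 slow.
  split; first exact: (slow_orbit_alpha0 sg gen Grepr alpha_ge0 zH T1 slow).
    exact/integrable_weightP.
  rewrite (integral_id_EFin iw); congr EFin.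
  exact: (slow_orbit_drift0 sg gen Grepr alpha_ge0 zH C1 T1 slow).
pose L := Num.sqrt (2 * Rintegral mu setT (@weight R)).
have c_asymp : cond_c -> forall z, UHP z ->
    [/\ complex.Re (phi t z) / Num.sqrt t @[t --> +oo] --> 0,
        complex.Im (phi t z) / Num.sqrt t @[t --> +oo] --> L
      & cmod (phi t z) / Num.sqrt t @[t --> +oo] --> L].
  move=> /c_drift_free[a0 iw b_int m0] z zH.
  exact: (orbit_asymptotics sg gen Grepr alpha_ge0 a0 iw b_int m0 zH dw).
have c_b : cond_c -> cond_b_all.
  by move=> hc z zH; have [_ _ /cvg_limf_esup_lty] := c_asymp hc z zH.
have c_a : cond_c -> extremal_rate phi.
  move=> hc; have [_ _ _ m0] := c_drift_free hc.
  exists L; split; first by rewrite sqrtr_gt0 mulr_gt0.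
  by move=> z zH; have [] := c_asymp hc z zH.
have a_b : extremal_rate phi -> cond_b_some.
  by move=> [l [_ /(_ _ iH) /cvg_limf_esup_lty ?]]; exists 'i%C.
have b_b : cond_b_all -> cond_b_some by move=> h; exists 'i%C; split => //; exact: h.
(* The implications form the cycle (a), (b) at one point, (c), (a), while (c) yields (b) at all
   points. *)
split; first by split => // /b_c /c_a.
- by split => // /b_c /c_b.
- by split => // /a_b /b_c.
move=> /a_b /b_c hc z zH; have [hX hY _] := c_asymp hc z zH.
have -> : ('i%C * ((Num.sqrt (2 * fine (\int[mu]_s (1 + s ^+ 2)%:E)))%:C)%C : CC R) =
    Complex 0 L.
  by rewrite mulrC; apply/eqP; rewrite eq_complex ReZ ImZ /= mulr0 mulr1 !eqxx.
apply: cvg_Complex => /=.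
  by under eq_fun do rewrite div_real ReZ mulrC.
by under eq_fun do rewrite div_real ImZ mulrC.
Qed.
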